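(* Let $\mathcal{T}$ be a trie with $N$ edges. Then there are at most $N+1$ distinct palindromes in $\mathcal{T}$ (the empty string being counted).
   Context: A trie $\mathcal{T}=(V,E)$ is a (finite) rooted tree whose edges are labeled by characters of an alphabet $\Sigma$ so that the out-going edges of every node (the edges to its children) carry pairwise distinct labels. For nodes $u,v$ such that $u=v$ or $u$ is an ancestor of $v$, $\mathsf{str}(u,v)$ is the concatenation of the edge labels along the downward path from $u$ to $v$ (the empty string $\varepsilon$ if $u=v$). A string is a palindrome if it equals its reversal; $\varepsilon$ is a palindrome. The distinct palindromes in $\mathcal{T}$ are the elements of the set of strings $\{\mathsf{str}(u,v) : \mathsf{str}(u,v) \text{ is a palindrome}\}$. *)

(* Defs.v *)
From mathcomp Require Import all_boot.
From mathcomp Require Import boolp classical_sets functions cardinality.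

Set Implicit Arguments.
Unset Strict Implicit.
Unset Printing Implicit Defensive.

Local Open Scope classical_set_scope.

Section Walk.
Variables (V E : finType) (src tgt : E -> V).

Fixpoint walk (u : V) (p : seq E) (v : V) : Prop :=
  if p is e :: q then src e = u /\ walk (tgt e) q v else u = v.

End Walk.

(* Edges form a type of their own, so that labels exist on edges only and the
   alphabet may be empty.  Edges point from parent to child: the root has no
   parent, every node has at most one incoming edge (so in particular there
   are no parallel edges), and every node is reachable from the root. *)
Record trie (Sigma : Type) := Trie {
  node : finType;
  edge : finType;
  src : edge -> node;
  tgt : edge -> node;
  label : edge -> Sigma;
  root : node;
  tgt_neq_root : forall e : edge, tgt e <> root;
  tgt_inj : injective tgt;
  root_reaches : forall v : node, exists p : seq edge, walk src tgt root p v;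
  label_inj : forall e f : edge, src e = src f -> label e = label f -> e = f
}.

Section Strings.
Variables (Sigma : Type) (T : trie Sigma).
Implicit Types (u v : node T) (p : seq (edge T)).

Definition down_path u p v : Prop := walk (@src _ T) (@tgt _ T) u p v.

Definition ancestor_or_self u v : Prop := exists p, down_path u p v.

(* The downward path is unique (down_path_uniq), so the choice made by xget is
   immaterial; if u is neither v nor an ancestor of v, the value is junk. *)
Definition str u v : seq Sigma :=
  [seq label e | e <- xget [::] [set p | down_path u p v]].

Lemma down_path_cat u p v q w :
  down_path u p v -> down_path v q w -> down_path u (p ++ q) w.
Proof.
by elim: p u => [|e p IH] u /= => [-> //|[-> up] vq]; split=> //; apply: IH.
Qed.

Lemma down_path_rcons u p e v :
  down_path u (rcons p e) v -> down_path u p (src e) /\ tgt e = v.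
Proof.
elim: p u => [|f p IH] u /= [eu h]; first by rewrite /down_path /= eu.
by have [h1 h2] := IH _ h; do !split.
Qed.

Lemma down_path_uniq u p q v : down_path u p v -> down_path u q v -> p = q.
Proof.
have from_root v' p' q' : down_path (root T) p' v' ->
    down_path (root T) q' v' -> p' = q'.
  elim/last_ind: p' q' v' => [|p' e IH] q' v'; case/lastP: q' => [|q' f] //.
  - by move=> <- /down_path_rcons[_ /tgt_neq_root].
  - by move=> /down_path_rcons[_ ev] rv; case: (tgt_neq_root (etrans ev (esym rv))).
  move=> /down_path_rcons[hp <-] /down_path_rcons[hq /tgt_inj fe].
  by rewrite fe in hq *; rewrite (IH _ _ hp hq).
have [r ru] := root_reaches u => up uq.
have := from_root _ _ _ (down_path_cat ru up) (down_path_cat ru uq).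
by move/(congr1 (drop (size r))); rewrite !drop_size_cat.
Qed.

Lemma strE u p v : down_path u p v -> str u v = map (@label _ T) p.
Proof.
move=> h; rewrite /str; congr map.
exact: (down_path_uniq (xgetI [::] (h : [set p | down_path u p v] p)) h).
Qed.

End Strings.

Definition palindrome (A : Type) (s : seq A) : Prop := s = rev s.

Definition distinct_palindromes (Sigma : Type) (T : trie Sigma) :
    set (seq Sigma) :=
  [set w | exists u v : node T,
     [/\ ancestor_or_self u v, w = str u v & palindrome (str u v)]].

(* Main.v *)
(** Send each node [v] to the longest palindromic suffix of the string read from
    the root to [v].  A palindrome [w] of the trie, taken at an occurrence whose
    lower end [v] has minimal depth, is the image of [v]: a longer palindromic
    suffix would have [w] as a prefix as well, giving a higher occurrence.
    Hence there are at most as many palindromes as nodes, i.e. [N + 1]. *)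
Require Import Defs.
From mathcomp Require Import all_boot.
From mathcomp Require Import boolp classical_sets functions cardinality.

Set Implicit Arguments.
Unset Strict Implicit.
Unset Printing Implicit Defensive.

Local Open Scope classical_set_scope.

Section LongestPalindromicSuffix.
Variable A : Type.
Implicit Types s a w : seq A.

Lemma palindromic_suffix_exists s : exists k, `[< palindrome (drop k s) >].
Proof. by exists (size s); rewrite drop_size; apply/asboolP. Qed.

Definition longest_palindromic_suffix s : seq A :=
  drop (ex_minn (palindromic_suffix_exists s)) s.

(** Reversing [a ++ w] fixes it and turns the suffix [w] into the prefix [rev w], which is [w]. *)
Lemma palindrome_suffix_prefix a w :
  palindrome w -> palindrome (a ++ w) -> take (size w) (a ++ w) = w.
Proof.
by rewrite /palindrome => pw ->; rewrite rev_cat -pw take_size_cat.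
Qed.

End LongestPalindromicSuffix.

Section Trie.
Variables (Sigma : Type) (T : trie Sigma).
Implicit Types (u v : node T) (p q r : seq (edge T)).

Lemma down_path_cat_inv u p q w : down_path u (p ++ q) w ->
  exists2 v, down_path u p v & down_path v q w.
Proof.
elim: p u => [|e p IH] u /=; first by exists u.
by case=> eu /IH[v pv vq]; exists v.
Qed.

(** Strong induction on the depth [size (r ++ p)] of [v] replaces the choice of a highest
    occurrence. *)
Lemma palindrome_longest_suffix u v r p :
    down_path (Defs.root T) r u -> down_path u p v ->
    palindrome (map (@label _ T) p) ->
  exists x, map (@label _ T) p = longest_palindromic_suffix (str (Defs.root T) x).
Proof.
have [n] := ubnP (size (r ++ p)); elim: n u v r p => // n IH u v r p.
rewrite ltnS => le_n ru uv pal_p; have rv := down_path_cat ru uv.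
have := erefl (longest_palindromic_suffix (str (Defs.root T) v)).
rewrite {2}/longest_palindromic_suffix (strE rv).
case: ex_minnP => k /asboolP pal_k min_k eq_k.
(* The string of [p] is itself a palindromic suffix, and it starts at position [size r]. *)
have : k <= size r.
  by apply: min_k; apply/asboolP; rewrite -map_drop drop_size_cat.
rewrite leq_eqVlt => /predU1P[kr|lt_kr].
  by exists v; rewrite (strE rv) eq_k kr -map_drop drop_size_cat.
move: pal_k; rewrite -map_drop drop_cat lt_kr map_cat.
move=> /(palindrome_suffix_prefix pal_p).
rewrite -map_cat size_map -map_take.
(* The longer palindrome along [q] begins with the string of [p]; the goal now speaks of that
   prefix, which ends at a proper ancestor of [v]. *)
set q := drop k r ++ p => eq_q; rewrite -eq_q.
have rpE : r ++ p = take k r ++ (take (size p) q ++ drop (size p) q).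
  by rewrite cat_take_drop catA cat_take_drop.
move: rv; rewrite rpE => /down_path_cat_inv[u' ru' /down_path_cat_inv[v' uv' _]].
apply: (IH u' v' (take k r)) => //; last by rewrite eq_q.
(* The new lower end has depth [k + size p], less than [size r + size p]. *)
apply: leq_trans le_n; rewrite !size_cat size_take lt_kr.
by rewrite size_takel ?ltn_add2r // size_cat leq_addl.
Qed.

(** Indexing nodes by incoming edges, with [None] for the root, gives the bound N + 1 without
    counting nodes. *)
Definition node_of_edge (o : option (edge T)) : node T :=
  if o is Some e then tgt e else Defs.root T.

Lemma node_of_edge_surj v : exists o, node_of_edge o = v.
Proof.
have [p] := root_reaches v; case/lastP: p => [<-|p e]; first by exists None.
by move=> /down_path_rcons[_ <-]; exists (Some e).
Qed.

End Trie.

Theorem lemma4 (Sigma : Type) (T : trie Sigma) (N : nat)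
    (edges_N : #|edge T| = N) :
  (distinct_palindromes T #<= `I_(N.+1))%card.
Proof.
pose f o := longest_palindromic_suffix (str (Defs.root T) (@node_of_edge _ T o)).
have sub : distinct_palindromes T `<=` f @` [set: option (edge T)].
  move=> w [u [v [[p uv] -> ]]]; rewrite (strE uv) => pal_p.
  have [r ru] := root_reaches u.
  have [x ->] := palindrome_longest_suffix ru uv pal_p.
  by have [o <-] := node_of_edge_surj x; exists o.
apply: card_le_trans (subset_card_le sub) _.
apply: card_le_trans (card_image_le _ _) _.
pose g (o : option (edge T)) : nat := enum_rank o.
have g_inj : injective g by move=> o o' /val_inj/enum_rank_inj.
rewrite -(card_le_eql (inj_card_eq (in2W g_inj))).
apply: subset_card_le => _ [o _ <-] /=.
by rewrite -edges_N -card_option ltn_ord.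
Qed.
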